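(* Let $X$ be a Baire space and $Y$ a Hausdorff topological space. Let $(f_n)$ be a bounded sequence in $\mathcal{M}(X,Y)$ and let $\varphi:X\to Y$ be a quasiminimal usco map with $[\varphi]=\{f\}$. Suppose that for each $x\in X$ the sequence of compact sets $f_n(x)$ cumulates at $\varphi(x)$, i.e. for each open set $U\subset Y$ containing $\varphi(x)$ there is some $n_0\in\mathbb{N}$ such that $f_n(x)\subset U$ for all $n\ge n_0$. Then the sequence $(f_n)$ converges to $f$ in $\mathcal{M}(X,Y)$.
   Context: A set-valued map $g:X\to Y$ is usco if $g(x)$ is a nonempty compact subset of $Y$ for each $x\in X$ and $\{x\in X: g(x)\subset U\}$ is open in $X$ for each open $U\subset Y$. Set-valued maps are identified with their graphs, so $h\subset g$ means $h(x)\subset g(x)$ for all $x\in X$. A usco map $g$ is minimal if $h=g$ for every usco $h:X\to Y$ with $h\subset g$. $\mathcal{M}(X,Y)$ is the set of all minimal usco maps from $X$ to $Y$. For a usco map $g$, $[g]=\{f\in\mathcal{M}(X,Y): f\subset g\}$; $g$ is quasiminimal if $[g]$ has exactly one element. A filter $\mathcal{F}$ on $\mathcal{M}(X,Y)$ is bounded if $[g]\in\mathcal{F}$ for some usco $g:X\to Y$; it converges to $f\in\mathcal{M}(X,Y)$ if it is bounded and $\{f\}=\bigcap\{[g]: g:X\to Y \text{ usco},\ [g]\in\mathcal{F}\}$. A sequence $(f_n)$ in $\mathcal{M}(X,Y)$ is bounded, respectively converges to $f$, if its Fréchet filter (generated by $\{\{f_m:m\ge n\}:n\in\mathbb{N}\}$)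 is bounded, respectively converges to $f$. No separation axioms are assumed on $X$. *)

(* Defs.v *)
From mathcomp Require Import all_boot all_order.
From mathcomp Require Import boolp classical_sets functions filter topology.

Set Implicit Arguments.
Unset Strict Implicit.
Unset Printing Implicit Defensive.

Local Open Scope classical_set_scope.

Definition baire_space (X : topologicalType) : Prop :=
  forall O : nat -> set X,
    (forall n, open (O n) /\ dense (O n)) -> dense (\bigcap_n O n).

(* Set-valued maps are functions X -> set Y; [map_incl h g] is inclusion of
   graphs. *)
Definition map_incl (X Y : Type) (h g : X -> set Y) : Prop :=
  forall x, h x `<=` g x.

Definition usco (X Y : topologicalType) (g : X -> set Y) : Prop :=
  (forall x, g x !=set0 /\ compact (g x)) /\
  (forall U : set Y, open U -> open [set x | g x `<=` U]).

Definition minimal_usco (X Y : topologicalType) (g : X -> set Y) : Prop :=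
  usco g /\ forall h : X -> set Y, usco h -> map_incl h g -> h = g.

(* M(X,Y), as a type, so that filters on it are the library's filters. *)
Definition minusco (X Y : topologicalType) : Type :=
  {f : X -> set Y | minimal_usco f}.

(* The set written [g] in the literature. *)
Definition minusco_below (X Y : topologicalType) (g : X -> set Y) :
    set (minusco X Y) :=
  [set f | map_incl (sval f) g].

Definition quasiminimal (X Y : topologicalType) (g : X -> set Y) : Prop :=
  usco g /\ exists! f : minusco X Y, minusco_below g f.

Definition bounded_filter (X Y : topologicalType)
    (F : set_system (minusco X Y)) : Prop :=
  exists g : X -> set Y, usco g /\ F (minusco_below g).

Definition filter_converges (X Y : topologicalType)
    (F : set_system (minusco X Y)) (f : minusco X Y) : Prop :=
  bounded_filter F /\
  [set f] = \bigcap_(g in [set g : X -> set Y | usco g /\ F (minusco_below g)])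
              minusco_below g.

Definition frechet_filter (T : Type) (u : nat -> T) : set_system T :=
  filter_from [set: nat] (fun n => u @` [set m | (n <= m)%N]).

Lemma frechet_filter_proper (T : Type) (u : nat -> T) :
  ProperFilter (frechet_filter u).
Proof.
apply: filter_from_proper; last by move=> n _; exists (u n), n => //=.
apply: filter_from_filter; first by exists 0%N.
move=> i j _ _; exists (maxn i j) => // _ [m /= + <-].
by rewrite geq_max => /andP[im jm]; split; exists m.
Qed.

Definition bounded_seq (X Y : topologicalType) (u : nat -> minusco X Y) :
    Prop :=
  bounded_filter (frechet_filter u).

Definition seq_converges (X Y : topologicalType) (u : nat -> minusco X Y)
    (f : minusco X Y) : Prop :=
  filter_converges (frechet_filter u) f.

Definition cumulates_at (Y : topologicalType) (K : nat -> set Y) (A : set Y) :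
    Prop :=
  forall U : set Y, open U -> A `<=` U ->
    exists n0 : nat, forall n : nat, (n0 <= n)%N -> K n `<=` U.

(* Main.v *)
(* Every usco map contains a minimal one (Zorn), and cutting an open set V out
   of the values of a usco map over an open set U leaves a usco map as long as
   no value becomes empty.
   If f were not below some bound g of a tail of the sequence, f would take
   values in an open set V over a nonempty open set O on which g takes values in
   an open set disjoint from V.  Since f_n(x) cumulates at phi(x), no phi(x) with
   x in O is inside V, so cutting V out of phi over O leaves a usco map; it
   contains a minimal one, which must be f, a contradiction.
   Conversely, if f' is a minimal usco map in the intersection of
   the sets [g] but f' is not below phi, then f' takes values in an open set V
   over a nonempty open set O on which phi takes values in an open set W
   disjoint from V.  Each point of O has eventually f_n inside W, so by Baire
   the set where f_m is inside W for all m >= n is dense in some nonempty open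
   O' for some n; by minimality no f_m with m >= n then meets V over O'.
   Cutting V over O' out of a bound g of the sequence gives another bound,
   which f' violates. *)
Require Import Defs.
From mathcomp Require Import all_boot all_order.
From mathcomp Require Import boolp classical_sets functions filter topology.

Local Open Scope classical_set_scope.

(** The sets [K] ∩ [B i] form a filter base; a cluster point of it in [K] lies in each closed
    [B i]. *)
Lemma compact_directed_bigcap (T : topologicalType) (I : Type) (K : set T)
    (D : set I) (B : I -> set T) :
  compact K -> D !=set0 ->
  (forall i j, D i -> D j -> exists2 k, D k & B k `<=` B i `&` B j) ->
  (forall i, D i -> closed (B i)) -> (forall i, D i -> K `&` B i !=set0) ->
  K `&` \bigcap_(i in D) B i !=set0.
Proof.
move=> cK [i0 Di0] dir clB KB.
pose F := filter_from D (fun i => K `&` B i).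
have FF : ProperFilter F.
  apply: filter_from_proper => //; apply: filter_from_filter; first by exists i0.
  move=> i j Di Dj; have [k Dk Bk] := dir i j Di Dj.
  by exists k => // y [Ky /Bk[Biy Bjy]].
have [|p [Kp clp]] := cK F FF; first by exists i0 => // y [].
exists p; split=> // i Di; apply: clB => // A Ap.
have [|q [[_ Bq] Aq]] := clp (K `&` B i) A _ Ap; last by exists q.
by exists i.
Qed.

(** If the closure of every neighbourhood of [y] met [K], compactness would give a point of [K] in
    all these closures, and in a Hausdorff space that point is [y]. *)
Lemma hausdorff_compact_separation (T : topologicalType) (K : set T) (y : T) :
  hausdorff_space T -> compact K -> ~ K y ->
  exists V W : set T,
    [/\ open V, open W, V y, K `<=` W & forall z, V z -> ~ W z].
Proof.
move=> hT cK Ky; apply: contrapT => nsep; apply: Ky.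
have [||||p [Kp clp]] :=
    @compact_directed_bigcap T (set T) K (nbhs y) closure cK.
- by exists setT; exact: filterT.
- move=> A B yA yB; exists (A `&` B); first exact: filterI.
  by move=> z zAB; split; apply: closureS zAB => ? [].
- by move=> A _; exact: closed_closure.
- move=> A; rewrite nbhsE => -[V [oV Vy] VA]; apply: contrapT => KA.
  apply: nsep; exists V, (~` closure A); split=> //.
  + by apply/closed_openC; exact: closed_closure.
  + by move=> z Kz Az; apply: KA; exists z.
  + by move=> z Vz; apply; apply: subset_closure; exact: VA.
suff -> : y = p by [].
by apply: hT => A B yA pB; exact: clp.
Qed.

Section Usco.
Variables X Y : topologicalType.
Implicit Types (g h : X -> set Y) (U : set X) (V : set Y).

Definition cut g U V : X -> set Y :=
  fun x => [set y | g x y /\ (U x -> ~ V y)].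

Lemma cut_incl g U V : map_incl (cut g U V) g.
Proof. by move=> x y []. Qed.

Lemma usco_cut g U V : usco g -> open U -> open V ->
  (forall x, U x -> ~ g x `<=` V) -> usco (cut g U V).
Proof.
move=> [gK gO] oU oV gV.
have cutU x : U x -> cut g U V x = g x `&` ~` V.
  by move=> Ux; apply/seteqP; split=> y [gy Vy]; split=> //; exact: Vy.
have cutNU x : ~ U x -> cut g U V x = g x.
  by move=> Ux; apply/seteqP; split=> y; [case|split].
split=> [x|W oW].
  have [gx0 gxK] := gK x; have [Ux|Ux] := pselect (U x); last by rewrite cutNU.
  rewrite cutU //; split; last first.
    by apply: compact_closedI => //; exact: open_closedC.
  apply: contrapT => gx; apply: (gV x Ux) => y gy.
  by apply: contrapT => Vy; apply: gx; exists y.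
suff -> : [set x | cut g U V x `<=` W] =
    [set x | g x `<=` W] `|` (U `&` [set x | g x `<=` V `|` W]).
  apply: openU; first exact: gO.
  by apply: openI => //; apply: gO; exact: openU.
apply/seteqP; split=> [x gW|x [gW|[Ux gW]]] /=.
- have [Ux|Ux] := pselect (U x); last by left; rewrite -(cutNU x).
  right; split=> // y gy; have [Vy|Vy] := pselect (V y); first by left.
  by right; apply: gW.
- by move=> y /cut_incl/gW.
- by move=> y [/gW[Vy /(_ Ux)|]].
Qed.

(** Otherwise cutting [V] out of [f] over [U] leaves a usco map that omits [y] at [x], against
    minimality. *)
Lemma minimal_usco_shrink f U V (x : X) (y : Y) :
  minimal_usco f -> open U -> open V -> U x -> f x y -> V y ->
  exists2 O : set X, open O /\ O !=set0 & O `<=` U /\ forall z, O z -> f z `<=` V.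
Proof.
move=> [uf fmin] oU oV Ux fy Vy.
exists (U `&` [set z | f z `<=` V]); last by split=> [z []|z []].
split; first by apply: openI => //; exact: uf.2.
apply: contrapT => UV.
have uh : usco (cut f U V).
  by apply: usco_cut => // z Uz fz; apply: UV; exists z.
have eqf := fmin _ uh (@cut_incl f U V).
by move: fy; rewrite -eqf => -[_ /(_ Ux)].
Qed.

Lemma usco_chain_bigcap (C : set (X -> set Y)) :
  hausdorff_space Y -> C !=set0 -> (forall g, C g -> usco g) ->
  total_on C (fun g h => map_incl h g) ->
  usco (fun x => \bigcap_(g in C) g x).
Proof.
move=> hY [g0 Cg0] uC tC.
have clC g x : C g -> closed (g x).
  by move=> Cg; apply: compact_closed => //; exact: ((uC g Cg).1 x).2.
(* By compactness. Empty [V] will give nonempty values, general [V] upper semicontinuity. *)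
have chain V x : open V -> \bigcap_(g in C) g x `<=` V ->
    exists2 g, C g & g x `<=` V.
  move=> oV CV; apply: contrapT => nC.
  have [|||||p [_ clp]] := @compact_directed_bigcap Y (X -> set Y) (g0 x) C
      (fun g => g x `&` ~` V).
  - exact: ((uC _ Cg0).1 x).2.
  - by exists g0.
  - move=> g h Cg Ch; have [gh|gh] := tC _ _ Cg Ch.
      by exists h => // y [hy Vy]; split=> //; split=> //; exact: gh.
    by exists g => // y [gy Vy]; split=> //; split=> //; exact: gh.
  - by move=> g Cg; apply: closedI; [exact: clC|exact: open_closedC].
  - move=> g Cg.
    (* The ambient compact set is [g0 x], hence the smaller of [g] and [g0]. *)
    have [h Ch [hg hg0]] : exists2 h, C h & h x `<=` g x /\ h x `<=` g0 x.
      by have [k|k] := tC _ _ Cg Cg0; [exists g0|exists g] => //; split=> //;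
        exact: k.
    apply: contrapT => gV; apply: nC; exists h => // y hy.
    apply: contrapT => Vy; apply: gV; exists y; split; first exact: hg0.
    by split=> //; exact: hg.
  by have [_ []] := clp g0 Cg0; apply: CV => g /clp[].
split=> [x|V oV].
  split; last first.
    apply: subclosed_compact (((uC _ Cg0).1 x).2) _; last by move=> y; exact.
    by apply: closed_bigI => g; exact: clC.
  apply: contrapT => C0; have [|g Cg] := chain _ x open0.
    by move=> y Cy; case: C0; exists y.
  by have [y gy] := ((uC _ Cg).1 x).1 => /(_ y gy).
suff -> : [set x | \bigcap_(g in C) g x `<=` V] =
    \bigcup_(g in C) [set x | g x `<=` V].
  by apply: bigcup_open => g /uC[_]; exact.
apply/seteqP; split=> [x /chain[]// g Cg gV|x [g Cg gV] y]; first by exists g.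
by move=> /(_ g Cg)/gV.
Qed.

Lemma minimal_usco_exists g : hausdorff_space Y -> usco g ->
  exists f : minusco X Y, minusco_below g f.
Proof.
move=> hY ug.
pose T := {h : X -> set Y | usco h /\ map_incl h g}.
(* Reversed inclusion, so that Zorn's maximal element is a minimal usco map. *)
pose R (a b : T) := `[< map_incl (sval b) (sval a) >].
have inclI h k : map_incl h k -> map_incl k h -> h = k.
  by move=> hk kh; apply/funext => x; apply/seteqP; split; [exact: hk|exact: kh].
have [||||[f [uf fg]] fmax] := @Zorn T R.
- by move=> a; apply/asboolP => x.
- by move=> a b c /asboolP ab /asboolP bc; apply/asboolP => x y /bc/ab.
- move=> [a pa] [b pb] /asboolP/= ba /asboolP/= ab.
  by apply: eq_exist; exact: inclI.
- move=> A totA; have [A0|A0] := pselect (A !=set0); last first.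
    have gg : usco g /\ map_incl g g by split=> // x.
    by exists (exist _ g gg) => s As; case: A0; exists s.
  pose C : set (X -> set Y) := [set sval a | a in A].
  pose k x := \bigcap_(h in C) h x.
  have uk : usco k.
    apply: usco_chain_bigcap => //.
    + by have [a Aa] := A0; exists (sval a), a.
    + by move=> _ [[h []] /= uh _ _ <-].
    + move=> _ _ [a Aa <-] [b Ab <-].
      by have [/asboolP|/asboolP] := totA _ _ Aa Ab; [left|right].
  have kA a : A a -> map_incl k (sval a).
    by move=> Aa x y /(_ (sval a)); apply; exists a.
  have kg : map_incl k g.
    have [[h [uh hg]] Ah] := A0.
    by move=> x y /(kA _ Ah); exact: hg.
  by exists (exist _ k (conj uk kg)) => s As; apply/asboolP; exact: kA.
have mf : minimal_usco f.
  split=> // h uh hf.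
  have hg : map_incl h g by move=> x y /hf/fg.
  by have /(_ (asboolT hf))/(congr1 sval) := fmax (exist _ h (conj uh hg)).
by exists (exist _ f mf).
Qed.

(** Otherwise the complements of the closures of [A n] ∩ [O] are dense and open, and Baire gives a
    point of [O] in no [A n]. *)
Lemma baire_open_cover (O : set X) (A : nat -> set X) :
  baire_space X -> open O -> O !=set0 -> O `<=` \bigcup_n A n ->
  exists n (U : set X), [/\ open U, U !=set0, U `<=` O & U `<=` closure (A n)].
Proof.
move=> bX oO O0 OA; apply: contrapT => nA.
have [|x [Ox clx]] := bX (fun n => ~` closure (A n `&` O)) _ O O0 oO.
  move=> n; split; first by apply/closed_openC; exact: closed_closure.
  move=> U [x Ux] oU; apply: contrapT => Un.
  have UA : U `<=` closure (A n `&` O).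
    by move=> z Uz; apply: contrapT => clz; apply: Un; exists z.
  apply: nA; exists n, (U `&` O); split=> [||z []//|z [/UA clz _]].
  - exact: openI.
  - have /(_ U)[|z [[_ Oz] Uz]] := UA x Ux; first exact: open_nbhs_nbhs.
    by exists z.
  - by apply: closureS clz => ? [].
have [n _ An] := OA x Ox; apply: (clx n I); exact: subset_closure.
Qed.

End Usco.

Arguments cut {X Y}.

(* Qualified, since topology exports another frechet_filter. *)
Lemma frechet_filter_belowP (X Y : topologicalType) (f_ : nat -> minusco X Y)
    (g : X -> set Y) :
  Defs.frechet_filter f_ (minusco_below g) <->
  exists n, forall m, (n <= m)%N -> map_incl (sval (f_ m)) g.
Proof.
split=> [[n _ fg]|[n fg]]; exists n => //.
  by move=> m nm; apply: fg; exists m.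
by move=> _ [m nm <-]; exact: fg.
Qed.

Lemma below_of_cumulates (X Y : topologicalType) (f_ : nat -> minusco X Y)
    (phi : X -> set Y) (f : minusco X Y) (g : X -> set Y) :
  hausdorff_space Y -> usco phi -> minusco_below phi = [set f] ->
  (forall x, cumulates_at (fun n => sval (f_ n) x) (phi x)) ->
  usco g -> Defs.frechet_filter f_ (minusco_below g) -> minusco_below g f.
Proof.
move=> hY uphi below_phi cumul ug /frechet_filter_belowP[n fg].
apply: contrapT => /existsNP[x /existsNP[y /not_implyP[fy gy]]].
have [V [W [oV oW Vy gW VW]]] :=
  @hausdorff_compact_separation _ _ _ hY (ug.1 x).2 gy.
have [O [oO [z Oz]] [OW fV]] :=
  minimal_usco_shrink _ _ (sval f) _ _ _ _ (svalP f) (ug.2 W oW) oV gW fy Vy.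
have [|f' f'cut] := @minimal_usco_exists X Y (cut phi O V) hY.
  apply: usco_cut => // u Ou phiV; have [n0 n0V] := cumul u V oV phiV.
  (* Past both [n] and [n0], a value at [u] would lie in [V] and in [W]. *)
  have [t ft] := ((svalP (f_ (maxn n n0))).1.1 u).1.
  apply: (VW t); first exact: n0V (leq_maxr _ _) _ ft.
  by apply: (OW u Ou); apply: fg ft; exact: leq_maxl.
have ff' : f' = f.
  suff : minusco_below phi f' by rewrite below_phi.
  by move=> u t /f'cut[].
rewrite ff' in f'cut; have [t ft] := ((svalP f).1.1 z).1.
by have [_ /(_ Oz)] := f'cut z t ft; apply; exact: fV ft.
Qed.

Lemma below_of_cumulates_baire (X Y : topologicalType)
    (f_ : nat -> minusco X Y) (phi : X -> set Y) (f : minusco X Y) :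
  baire_space X -> hausdorff_space Y -> bounded_seq f_ -> usco phi ->
  (forall x, cumulates_at (fun n => sval (f_ n) x) (phi x)) ->
  (forall g, usco g -> Defs.frechet_filter f_ (minusco_below g) ->
    minusco_below g f) ->
  minusco_below phi f.
Proof.
move=> bX hY [g [ug /frechet_filter_belowP[N fg]]] uphi cumul fall.
apply: contrapT => /existsNP[x /existsNP[y /not_implyP[fy phiy]]].
have [V [W [oV oW Vy phiW VW]]] :=
  @hausdorff_compact_separation _ _ _ hY (uphi.1 x).2 phiy.
have [O [oO O0] [OW fV]] := minimal_usco_shrink _ _ (sval f) _ _ _ _ (svalP f)
  (uphi.2 W oW) oV phiW fy Vy.
pose A n := [set u | forall m, (n <= m)%N -> sval (f_ m) u `<=` W].
have [|n [U [oU [z Uz] UO UA]]] := @baire_open_cover X O A bX oO O0.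
  by move=> u /OW phiu; have [n nW] := cumul u W oW phiu; exists n.
(* Otherwise [f_ m] maps a nonempty open part of [U] into [V]; that part contains a point of [A n],
   where [f_ m] lies in [W]. *)
have UV m u t : (n <= m)%N -> U u -> sval (f_ m) u t -> ~ V t.
  move=> nm Uu ft Vt.
  have [O' [oO' [v O'v]] [O'U O'V]] :=
    minimal_usco_shrink _ _ (sval (f_ m)) _ _ _ _ (svalP (f_ m)) oU oV Uu ft Vt.
  have [|w [Aw O'w]] := UA v (O'U _ O'v) O'; first exact: open_nbhs_nbhs.
  have [s fs] := ((svalP (f_ m)).1.1 w).1.
  by apply: (VW s); [exact: O'V fs|exact: Aw fs].
have [t ft] := ((svalP f).1.1 z).1.
have fcut : minusco_below (cut g U V) f.
  apply: fall.
    apply: usco_cut => // u Uu gV.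
    have [s fs] := ((svalP (f_ (maxn n N))).1.1 u).1.
    apply: (UV _ u s (leq_maxl n N) Uu fs); apply: gV.
    exact: fg (leq_maxr n N) _ _ fs.
  (* From [N] on the sequence is below [g], from [n] on it avoids [V] over [U]. *)
  apply/frechet_filter_belowP; exists (maxn n N) => m; rewrite geq_max.
  move=> /andP[nm Nm] u s fs; split; first exact: fg fs.
  by move=> Uu; exact: UV fs.
by have [_ /(_ Uz)] := fcut z t ft; apply; apply: fV ft; exact: UO.
Qed.

Theorem theorem17 (X Y : topologicalType)
    (baireX : baire_space X) (hausdorffY : hausdorff_space Y)
    (f_ : nat -> minusco X Y) (bounded_f_ : bounded_seq f_)
    (phi : X -> set Y) (quasimin_phi : quasiminimal phi)
    (f : minusco X Y) (below_phi : minusco_below phi = [set f])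
    (cumul : forall x : X, cumulates_at (fun n => sval (f_ n) x) (phi x)) :
  seq_converges f_ f.
Proof.
have [uphi _] := quasimin_phi.
split=> //; apply/seteqP; split=> [_ ->|f' f'all].
  move=> g [ug fg]; exact: (@below_of_cumulates X Y f_ phi).
(* Quasiminimality reduces [f' = f] to [f'] being below [phi]. *)
rewrite -below_phi; apply: (@below_of_cumulates_baire X Y f_) => //.
by move=> g ug fg; exact: f'all.
Qed.
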